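(* Let $(X,d_X)$ be a metric space that satisfies the $\boxtimes$-inequalities. Then for any integer $n\geq 3$ and any map $f:\mathbb{Z}/n\mathbb{Z}\to X$ satisfying $f(j)\neq f(j+[1]_n)$ for every $j\in\mathbb{Z}/n\mathbb{Z}$, there exists a map $g:\mathbb{Z}/n\mathbb{Z}\to\mathbb{R}^2$ satisfying the following two conditions: (1) For any $i,j\in\mathbb{Z}/n\mathbb{Z}$, $$\|g(i)-g(i+[1]_n)\|=d_X(f(i),f(i+[1]_n)),\qquad \|g(i)-g(j)\|\geq d_X(f(i),f(j)).$$ (2) For any $i,j\in\mathbb{Z}/n\mathbb{Z}$ with $i\neq j$, $[g(i),g(j)]\cap[g(i-[1]_n),g(i+[1]_n)]\neq\emptyset$.
   Context: $\|\cdot\|$ is the Euclidean norm on $\mathbb{R}^2$, and $[a,b]$ denotes the line segment in $\mathbb{R}^2$ with endpoints $a$ and $b$ (so $[a,a]=\{a\}$). $[m]_n$ denotes the class of the integer $m$ in $\mathbb{Z}/n\mathbb{Z}$. Definition. A metric space $(X,d_X)$ satisfies the $\boxtimes$-inequalities if for any $t,s\in[0,1]$ and any $x,y,z,w\in X$, $$0\leq (1-t)(1-s)d_X(x,y)^2+t(1-s)d_X(y,z)^2+ts\,d_X(z,w)^2+(1-t)s\,d_X(w,x)^2-t(1-t)d_X(x,z)^2-s(1-s)d_X(y,w)^2.$$ *)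

(* Defs.v *)
From HB Require Import structures.
From mathcomp Require Import all_boot all_order all_algebra.
From mathcomp Require Import all_classical all_reals all_analysis.

Set Implicit Arguments.
Unset Strict Implicit.
Unset Printing Implicit Defensive.

Import Order.TTheory GRing.Theory Num.Theory.

Local Open Scope classical_set_scope.
Local Open Scope ring_scope.

Definition boxtimes_inequalities (R : realType) (X : metricType R) : Prop :=
  forall (t s : R) (x y z w : X), 0 <= t <= 1 -> 0 <= s <= 1 ->
    0 <= (1 - t) * (1 - s) * mdist x y ^+ 2 + t * (1 - s) * mdist y z ^+ 2
         + t * s * mdist z w ^+ 2 + (1 - t) * s * mdist w x ^+ 2
         - t * (1 - t) * mdist x z ^+ 2 - s * (1 - s) * mdist y w ^+ 2.

(* The library norm on row vectors is the sup norm, hence this definition. *)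
Definition enorm (R : realType) (n : nat) (v : 'rV[R]_n) : R :=
  Num.sqrt (\sum_(k < n) v ord0 k ^+ 2).

Definition segment (R : realType) (n : nat) (a b : 'rV[R]_n) : set 'rV[R]_n :=
  [set (1 - t) *: a + t *: b | t in [set t : R | 0 <= t <= 1]].

(* Main.v *)
Require Import Defs.
From mathcomp Require Import all_boot all_order all_algebra.
From mathcomp Require Import all_classical all_reals all_analysis.
From mathcomp Require Import ring lra zify.

Set Implicit Arguments.
Unset Strict Implicit.
Unset Printing Implicit Defensive.

Import Order.TTheory GRing.Theory Num.Theory.
Import numFieldNormedType.Exports.

Local Open Scope classical_set_scope.
Local Open Scope ring_scope.

(* Induction on the number of vertices, for an arbitrary distance function
   satisfying the boxtimes inequalities.  Majorize the polygon without its last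
   vertex by a convex polygon g 0, ..., g m, and attach to the side
   E = [g 0, g m] a flat triangle with apex p, on the other side of the line.
   If every segment [p, g j] meets E, the enlarged polygon is convex, and the
   boxtimes inequality at the crossing point gives d(j, m+1) <= |g j - p|.
   Otherwise consider the plane and the triangle glued along E, i.e. the
   distance min over q in E of |p - q| + |q - y| from p to y.  This distance
   dominates d and again satisfies the boxtimes inequalities, because its
   square minus |y|^2 is convex in y.  Some shortest broken line from p to g j
   turns at an endpoint of E, hence so does the one to the neighbour of that
   endpoint; in the glued metric the endpoint then lies straight between its
   two neighbours.  The induction hypothesis, applied to the glued metric
   without this vertex, yields a convex polygon, and the vertex is put back on
   the corresponding side. *)

(** * Euclidean vectors and segments *)

Definition dot (R : realType) (n : nat) (u v : 'rV[R]_n) : R :=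
  \sum_(k < n) u ord0 k * v ord0 k.

Section Euclidean.
Variables (R : realType) (n : nat).
Implicit Types (a b c u v w x y z p q : 'rV[R]_n) (s t : R).

Lemma dotC u v : dot u v = dot v u.
Proof. by apply: eq_bigr => k _; rewrite mulrC. Qed.

Lemma dotDl u v w : dot (u + v) w = dot u w + dot v w.
Proof. by rewrite -big_split; apply: eq_bigr => k _; rewrite mxE mulrDl. Qed.

Lemma dotZl s u v : dot (s *: u) v = s * dot u v.
Proof. by rewrite mulr_sumr; apply: eq_bigr => k _; rewrite mxE mulrA. Qed.

Lemma dotDr u v w : dot u (v + w) = dot u v + dot u w.
Proof. by rewrite dotC dotDl !(dotC u). Qed.

Lemma dotZr s u v : dot u (s *: v) = s * dot u v.
Proof. by rewrite dotC dotZl dotC. Qed.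

Lemma dotNl u v : dot (- u) v = - dot u v.
Proof. by rewrite -scaleN1r dotZl mulN1r. Qed.

Lemma dotNr u v : dot u (- v) = - dot u v.
Proof. by rewrite dotC dotNl dotC. Qed.

Definition dotE := (dotDl, dotDr, dotNl, dotNr, dotZl, dotZr).

Lemma enormE u : enorm u = Num.sqrt (dot u u).
Proof. by congr Num.sqrt; apply: eq_bigr => k _; rewrite expr2. Qed.

Lemma dot_ge0 u : 0 <= dot u u.
Proof. by apply: sumr_ge0 => k _; rewrite -expr2 sqr_ge0. Qed.

Lemma enorm_ge0 u : 0 <= enorm u.
Proof. exact: sqrtr_ge0. Qed.

Lemma sqr_enorm u : enorm u ^+ 2 = dot u u.
Proof. by rewrite enormE sqr_sqrtr ?dot_ge0. Qed.

Lemma enorm_eq s u : 0 <= s -> dot u u = s ^+ 2 -> enorm u = s.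
Proof. by move=> a0 h; rewrite enormE h sqrtr_sqr ger0_norm. Qed.

Lemma enormZ s u : enorm (s *: u) = `|s| * enorm u.
Proof.
apply: enorm_eq; first by rewrite mulr_ge0 ?enorm_ge0.
by rewrite !dotE exprMn sqr_enorm real_normK ?num_real// expr2 mulrA.
Qed.

Lemma enormN u : enorm (- u) = enorm u.
Proof. by rewrite -scaleN1r enormZ normrN1 mul1r. Qed.

Lemma enormB u v : enorm (u - v) = enorm (v - u).
Proof. by rewrite -enormN opprB. Qed.

Lemma enorm0 : enorm (0 : 'rV[R]_n) = 0.
Proof. by rewrite -(scale0r 0) enormZ normr0 mul0r. Qed.

Lemma dot_eq0 u : dot u u = 0 -> u = 0.
Proof.
move=> /eqP; rewrite psumr_eq0 => [/allP h|k _]; last by rewrite -expr2 sqr_ge0.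
apply/rowP => k; rewrite mxE; apply/eqP.
by have := h k (mem_index_enum _); rewrite -expr2 sqrf_eq0.
Qed.

Lemma enorm_eq0 u : enorm u = 0 -> u = 0.
Proof. by move=> h; apply: dot_eq0; rewrite -sqr_enorm h expr0n. Qed.

Lemma dot_le_enorm u v : dot u v <= enorm u * enorm v.
Proof.
have [|nz] := boolP (enorm u * enorm v == 0).
  rewrite mulf_eq0 => /orP[]/eqP/enorm_eq0 ->; rewrite -(scale0r 0) ?dotZl ?dotZr;
  by rewrite mul0r mulr_ge0 ?enorm_ge0.
have pos : 0 < enorm u * enorm v by rewrite lt0r nz mulr_ge0 ?enorm_ge0.
have := dot_ge0 (enorm v *: u - enorm u *: v).
rewrite !dotE (dotC v u) -!sqr_enorm => h.
by rewrite -(ler_pM2l pos); nra.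
Qed.

Lemma enormD u v : enorm (u + v) <= enorm u + enorm v.
Proof.
rewrite -(@ler_pXn2r _ 2)// ?nnegrE ?addr_ge0 ?enorm_ge0//.
by rewrite sqrrD !sqr_enorm !dotE (dotC v u); have := dot_le_enorm u v; lra.
Qed.

Lemma enorm_triangle x y z : enorm (x - z) <= enorm (x - y) + enorm (y - z).
Proof. by apply: le_trans (enormD _ _); rewrite addrA subrK. Qed.

(** Stewart's identity, the Euclidean model of the hypotheses of [boxtimes_through]. *)
Lemma sqr_enorm_conv t x z y :
  enorm ((1 - t) *: x + t *: z - y) ^+ 2 =
  (1 - t) * enorm (x - y) ^+ 2 + t * enorm (z - y) ^+ 2
  - t * (1 - t) * enorm (x - z) ^+ 2.
Proof.
by rewrite !sqr_enorm !dotE (dotC z x) (dotC y x) (dotC y z); ring.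
Qed.

Lemma enorm_conv t x z y : 0 <= t <= 1 ->
  enorm ((1 - t) *: x + t *: z - y) <=
  (1 - t) * enorm (x - y) + t * enorm (z - y).
Proof.
move=> /andP[t0 t1].
have -> : (1 - t) *: x + t *: z - y = (1 - t) *: (x - y) + t *: (z - y).
  by apply/rowP => k; rewrite !mxE; ring.
by apply: le_trans (enormD _ _) _; rewrite !enormZ !ger0_norm ?subr_ge0.
Qed.

Lemma segment_left x y : segment x y x.
Proof.
exists 0; first by rewrite /= lexx ler01.
by rewrite subr0 scale1r scale0r addr0.
Qed.

Lemma segmentC x y : segment x y = segment y x.
Proof.
suff h x' y' : segment x' y' `<=` segment y' x' by apply/seteqP; split; exact: h.
move=> _ [t /= /andP[t0 t1] <-]; exists (1 - t); first by apply/andP; split; lra.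
by rewrite addrC opprB addrCA subrr addr0.
Qed.

Lemma segment_right x y : segment x y y.
Proof. by rewrite segmentC; exact: segment_left. Qed.

Lemma segment_convex a b x y : segment a b x -> segment a b y ->
  segment x y `<=` segment a b.
Proof.
move=> [s /= /andP[s0 s1] <-] [t /= /andP[t0 t1] <-] _ [r /= /andP[r0 r1] <-].
exists ((1 - r) * s + r * t); last by apply/rowP => k; rewrite !mxE; ring.
by apply/andP; split; nra.
Qed.

Lemma enorm_segment x y q : segment x y q ->
  enorm (x - y) = enorm (x - q) + enorm (q - y).
Proof.
move=> [t /= /andP[t0 t1] <-].
have -> : x - ((1 - t) *: x + t *: y) = t *: (x - y).
  by apply/rowP => k; rewrite !mxE; ring.
have -> : (1 - t) *: x + t *: y - y = (1 - t) *: (x - y).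
  by apply/rowP => k; rewrite !mxE; ring.
by rewrite !enormZ !ger0_norm ?subr_ge0// -mulrDl addrCA subrr addr0 mul1r.
Qed.

Definition meet x z y w : Prop := segment x z `&` segment y w !=set0.

Lemma meet_swap x z y w : meet x z y w -> meet y w x z.
Proof. by rewrite /meet setIC. Qed.

Lemma meet_revl x z y w : meet x z y w -> meet z x y w.
Proof. by rewrite /meet segmentC. Qed.

Lemma meet_revr x z y w : meet x z y w -> meet x z w y.
Proof. by move=> /meet_swap/meet_revl/meet_swap. Qed.

(** Two cevians of the triangle [a b c] cross; the common point is given in barycentric coordinates,
    except when [s * t = 1], where [x = b] and [y = c]. *)
Lemma pasch a b c x y : segment a b x -> segment a c y -> meet b y c x.
Proof.
move=> [s /= /andP[s0 s1] <-] [t /= /andP[t0 t1] <-].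
have [st1|st1] := eqVneq (s * t) 1.
  have [-> ->] : s = 1 /\ t = 1 by split; nra.
  exists b; split; first exact: segment_left.
  by rewrite subrr scale0r add0r scale1r; exact: segment_right.
have lt1 : 0 < 1 - s * t by rewrite subr_gt0 lt_neqAle st1; nra.
have nz : 1 - s * t != 0 by rewrite gt_eqF.
exists (((1 - s) * (1 - t) / (1 - s * t)) *: a
       + (s * (1 - t) / (1 - s * t)) *: b
       + (t * (1 - s) / (1 - s * t)) *: c); split.
- exists ((1 - s) / (1 - s * t)).
    by rewrite /= ler_pdivlMr// ler_pdivrMr//; apply/andP; split; nra.
  by apply/rowP => k; rewrite !mxE; field.
- exists ((1 - t) / (1 - s * t)).
    by rewrite /= ler_pdivlMr// ler_pdivrMr//; apply/andP; split; nra.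
  by apply/rowP => k; rewrite !mxE; field.
Qed.

Lemma meet_pasch a b c b' c' x y :
  segment a b x -> segment c c' x -> segment a c y -> segment b b' y ->
  meet b b' c c'.
Proof.
move=> abx ccx acy bby; have [r [h1 h2]] := pasch abx acy.
by exists r; split; [apply: segment_convex h1 => //; exact: segment_left
                    |apply: segment_convex h2 => //; exact: segment_left].
Qed.

End Euclidean.

(** * Boxtimes metrics and gluing *)

(** Distinct points may be at distance 0, so that the notion is stable under pullback by any map;
    the triangle inequality is derived in [boxtimes_triangle]. *)
Definition boxtimes_metric (R : realType) (T : Type) (d : T -> T -> R) : Prop :=
  [/\ forall x, d x x = 0, forall x y, d x y = d y x, forall x y, 0 <= d x y &
  forall (t s : R) (x y z w : T), 0 <= t <= 1 -> 0 <= s <= 1 ->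
    0 <= (1 - t) * (1 - s) * d x y ^+ 2 + t * (1 - s) * d y z ^+ 2
         + t * s * d z w ^+ 2 + (1 - t) * s * d w x ^+ 2
         - t * (1 - t) * d x z ^+ 2 - s * (1 - s) * d y w ^+ 2].

Lemma boxtimes_metric_comp (R : realType) (T U : Type) (h : U -> T)
    (d : T -> T -> R) :
  boxtimes_metric d -> boxtimes_metric (fun x y => d (h x) (h y)).
Proof.
move=> [d0 dC dge0 box]; split=> *;
by [exact: d0|exact: dC|exact: dge0|exact: box].
Qed.

Section BoxtimesMetric.
Variables (R : realType) (T : Type) (d : T -> T -> R).
Hypothesis bd : boxtimes_metric d.

(* [a] and [b] play the distances from [y] and [w] to a (possibly missing)
   point dividing [x, z] in the ratio t : 1 - t. *)
Lemma boxtimes_through (t : R) x y z w (a b : R) : 0 <= t <= 1 -> 0 <= a -> 0 <= b ->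
  (1 - t) * d x y ^+ 2 + t * d y z ^+ 2 - t * (1 - t) * d x z ^+ 2 <= a ^+ 2 ->
  (1 - t) * d x w ^+ 2 + t * d w z ^+ 2 - t * (1 - t) * d x z ^+ 2 <= b ^+ 2 ->
  d y w <= a + b.
Proof.
have [_ dC _ box] := bd.
move=> t01 a0 b0 ha hb; rewrite leNgt; apply/negP => lt.
(* The slack [e] makes [a + e] and [b + e] positive with sum [D], so that [[y, w]] can be divided in
   their ratio even when [a = b = 0]. *)
set e := (d y w - a - b) / 2; set D := d y w in lt e *.
have e0 : 0 < e by rewrite /e; lra.
have De : D = (a + e) + (b + e) by rewrite /e; field.
have D0 : 0 < D by lra.
pose s := (a + e) / D.
have s01 : 0 <= s <= 1.
  by rewrite /s ler_pdivlMr// ler_pdivrMr//; apply/andP; split; lra.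
have sD : s * D = a + e by rewrite /s divfK ?gt_eqF.
have := box t s x y z w t01 s01; rewrite -/D (dC w x) (dC z w) => h.
clearbody s D.
have {}h : s * (1 - s) * D ^+ 2 <= (1 - s) * a ^+ 2 + s * b ^+ 2.
  case/andP: s01 => s0 s1; have s1' : 0 <= 1 - s by lra.
  have := ler_wpM2l s1' ha; have := ler_wpM2l s0 hb; lra.
have e1 : s * (1 - s) * D ^+ 2 = (a + e) * (b + e).
  have -> : s * (1 - s) * D ^+ 2 = (s * D) * (D - s * D) by ring.
  by rewrite sD; congr (_ * _); rewrite De; ring.
have e2 : D * ((1 - s) * a ^+ 2 + s * b ^+ 2) = (b + e) * a ^+ 2 + (a + e) * b ^+ 2.
  have -> : D * ((1 - s) * a ^+ 2 + s * b ^+ 2)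
      = (D - s * D) * a ^+ 2 + (s * D) * b ^+ 2 by ring.
  by rewrite sD; congr (_ * _ + _); rewrite De; ring.
move: h; rewrite e1 -(ler_pM2l D0) e2 De => h.
have : 0 < (b + e) * e * (2 * a + e) by rewrite !mulr_gt0//; lra.
have : 0 < (a + e) * e * (2 * b + e) by rewrite !mulr_gt0//; lra.
by clear De; lra.
Qed.

Lemma boxtimes_triangle y x w : d y w <= d y x + d x w.
Proof.
have [d0 dC dge0 _] := bd.
by apply: (@boxtimes_through 0 x y x w); rewrite ?lexx ?ler01 ?dge0//
  d0 ?(dC x y) ?(dC w x); lra.
Qed.

End BoxtimesMetric.

(** * Broken lines through a segment and the glued metric *)

Section Gluing.
Variables (R : realType) (n : nat).
Implicit Types (a b c u v w x y z p q e : 'rV[R]_n) (s t : R).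

(** Joint convexity of |z|^2 / (2k), whose values are [c1] and [c2], in a form that admits [k = 0].
    The cross term is bounded by Cauchy-Schwarz and the inequality of means. *)
Lemma dot_conv_perspective s (k1 k2 c1 c2 : R) z1 z2 :
  0 <= s <= 1 -> 0 <= k1 -> 0 <= k2 -> 0 <= c1 -> 0 <= c2 ->
  dot z1 z1 = 2 * k1 * c1 -> dot z2 z2 = 2 * k2 * c2 ->
  let z := (1 - s) *: z1 + s *: z2 in
  dot z z <= 2 * ((1 - s) * k1 + s * k2) * ((1 - s) * c1 + s * c2).
Proof.
move=> /andP[s0 s1] k10 k20 c10 c20 h1 h2 /=.
have h : dot z1 z2 <= k1 * c2 + k2 * c1.
  apply: le_trans (dot_le_enorm _ _) _.
  rewrite -(@ler_pXn2r _ 2)// ?nnegrE ?addr_ge0 ?mulr_ge0 ?enorm_ge0//.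
  rewrite exprMn !sqr_enorm h1 h2 -subr_ge0.
  by have := sqr_ge0 (k1 * c2 - k2 * c1); lra.
rewrite !dotE (dotC z2 z1) h1 h2 -subr_ge0.
have := mulr_ge0 (mulr_ge0 s0 (_ : 0 <= 1 - s)) (_ : 0 <= k1 * c2 + k2 * c1 - dot z1 z2).
by rewrite !subr_ge0 => /(_ s1 h); lra.
Qed.

(* With kappa = |v| / |u|, the defect |u||v| - u.v equals
   |v - kappa u|^2 / (2 kappa), which is jointly convex in (v - kappa u, kappa);
   this dictates the weights (1 + kappa_i) of the point [q]. *)
Lemma broken_line_defect s q1 q2 u1 u2 v1 v2 p :
  0 <= s <= 1 -> u1 = q1 - p -> u2 = q2 - p ->
  exists2 q, segment q1 q2 q &
    let u := q - p in
    let v := (1 - s) *: (u1 + v1) + s *: (u2 + v2) - u in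
    enorm u * enorm v - dot u v <=
    (1 - s) * (enorm u1 * enorm v1 - dot u1 v1)
    + s * (enorm u2 * enorm v2 - dot u2 v2).
Proof.
move=> /andP[s0 s1] u1E u2E.
have c10 : 0 <= enorm u1 * enorm v1 - dot u1 v1 by rewrite subr_ge0 dot_le_enorm.
have c20 : 0 <= enorm u2 * enorm v2 - dot u2 v2 by rewrite subr_ge0 dot_le_enorm.
have rhs0 : 0 <= (1 - s) * (enorm u1 * enorm v1 - dot u1 v1)
    + s * (enorm u2 * enorm v2 - dot u2 v2) by rewrite addr_ge0 ?mulr_ge0// subr_ge0.
have dot0l w : dot 0 w = 0 by rewrite -(scale0r 0) dotZl mul0r.
(* If [q1 = p], the choice [q = q1] makes [u] and the left-hand side vanish; likewise for [q2]
   below. *)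
have [/enorm_eq0 u10|n1] := eqVneq (enorm u1) 0.
  exists q1; first exact: segment_left.
  by rewrite /= -u1E; apply: le_trans rhs0; rewrite u10 enorm0 dot0l mul0r subr0.
have [/enorm_eq0 u20|n2] := eqVneq (enorm u2) 0.
  exists q2; first exact: segment_right.
  by rewrite /= -u2E; apply: le_trans rhs0; rewrite u20 enorm0 dot0l mul0r subr0.
have p1 : 0 < enorm u1 by rewrite lt0r n1 enorm_ge0.
have p2 : 0 < enorm u2 by rewrite lt0r n2 enorm_ge0.
set c1 := enorm u1 * enorm v1 - dot u1 v1 in c10 rhs0 *.
set c2 := enorm u2 * enorm v2 - dot u2 v2 in c20 rhs0 *.
pose k1 := enorm v1 / enorm u1; pose k2 := enorm v2 / enorm u2.
have k10 : 0 <= k1 by rewrite divr_ge0 ?enorm_ge0.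
have k20 : 0 <= k2 by rewrite divr_ge0 ?enorm_ge0.
pose k := (1 - s) * k1 + s * k2.
have s1' : 0 <= 1 - s by rewrite subr_ge0.
have k0 : 0 <= k by apply: addr_ge0; apply: mulr_ge0.
have k1n : 1 + k != 0 by rewrite gt_eqF// ltr_pwDl.
pose t := s * (1 + k2) / (1 + k).
have tE : 1 - t = (1 - s) * (1 + k1) / (1 + k).
  by rewrite /t; apply: (mulIf k1n); rewrite mulrBl !divfK// /k; ring.
exists ((1 - t) *: q1 + t *: q2).
  exists t => //=; apply/andP; split.
    by apply: divr_ge0; [apply: mulr_ge0 => //|]; apply: addr_ge0.
  by rewrite -subr_ge0 tE; apply: divr_ge0; [apply: mulr_ge0 => //|]; apply: addr_ge0.
move=> u v.
pose z1 := v1 - k1 *: u1; pose z2 := v2 - k2 *: u2.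
have zz1 : dot z1 z1 = 2 * k1 * c1.
  rewrite /z1 !dotE (dotC v1 u1) -!sqr_enorm /c1.
  have -> : enorm v1 = k1 * enorm u1 by rewrite /k1 divfK.
  by ring.
have zz2 : dot z2 z2 = 2 * k2 * c2.
  rewrite /z2 !dotE (dotC v2 u2) -!sqr_enorm /c2.
  have -> : enorm v2 = k2 * enorm u2 by rewrite /k2 divfK.
  by ring.
have uE : u = (1 - t) *: u1 + t *: u2.
  by rewrite u1E u2E /u; apply/rowP => i; rewrite !mxE; ring.
(* The choice of [t] makes [(1 + k) u] the combination of [(1 + k1) u1] and [(1 + k2) u2] with
   weights [1 - s] and [s]. *)
have zE : (1 - s) *: z1 + s *: z2 = v - k *: u.
  have e : (1 + k) *: u = ((1 - s) * (1 + k1)) *: u1 + (s * (1 + k2)) *: u2.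
    by rewrite uE tE /t scalerDr !scalerA ![(1 + k) * _]mulrC !divfK.
  have -> : v - k *: u = (1 - s) *: (u1 + v1) + s *: (u2 + v2) - (1 + k) *: u.
    by rewrite [(1 + k) *: u]scalerDl scale1r opprD addrA.
  by rewrite e /z1 /z2; apply/rowP => i; rewrite !mxE; ring.
have s01 : 0 <= s <= 1 by apply/andP.
have := dot_conv_perspective s01 k10 k20 c10 c20 zz1 zz2; rewrite /= zE -/k.
set c := (1 - s) * c1 + s * c2 => h.
have [kz|kn] := eqVneq k 0.
  have v0 : v = 0.
    move: h; rewrite kz scale0r subr0 mulr0 mul0r => h.
    by apply: dot_eq0; apply/eqP; rewrite eq_le h dot_ge0.
  by rewrite v0 enorm0 mulr0 dotC dot0l subr0.
have kp : 0 < k by rewrite lt0r kn.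
(* The identity used is 2k(|u||v| - u.v) = |v - k u|^2 - (|v| - k|u|)^2. *)
rewrite -(ler_pM2l (_ : 0 < 2 * k)) ?mulr_gt0//.
clearbody u v; apply: le_trans h; rewrite !dotE (dotC v u) -!sqr_enorm.
by have := sqr_ge0 (enorm v - k * enorm u); lra.
Qed.

(** The squared length of a broken line is |y - p|^2 plus twice its defect: the first summand obeys
    Stewart's identity, the second is handled by [broken_line_defect]. *)
Lemma broken_line_convex s p q1 q2 y1 y2 : 0 <= s <= 1 ->
  exists2 q, segment q1 q2 q &
    (enorm (p - q) + enorm (q - ((1 - s) *: y1 + s *: y2))) ^+ 2 <=
    (1 - s) * (enorm (p - q1) + enorm (q1 - y1)) ^+ 2
    + s * (enorm (p - q2) + enorm (q2 - y2)) ^+ 2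
    - s * (1 - s) * enorm (y1 - y2) ^+ 2.
Proof.
move=> s01.
have [q qE h] := broken_line_defect (y1 - q1) (y2 - q2) s01
  (erefl (q1 - p)) (erefl (q2 - p)).
exists q => //; move: h; rewrite /=.
have -> : q1 - p + (y1 - q1) = y1 - p by rewrite addrC addrA subrK.
have -> : q2 - p + (y2 - q2) = y2 - p by rewrite addrC addrA subrK.
have sqE x y : (enorm (p - x) + enorm (x - y)) ^+ 2
    = enorm (y - p) ^+ 2
      + 2 * (enorm (x - p) * enorm (y - x) - dot (x - p) (y - x)).
  rewrite (enormB p x) (enormB x y) sqrrD !sqr_enorm.
  have -> : y - p = (x - p) + (y - x) by rewrite [RHS]addrC addrA subrK.
  by move: (x - p) (y - x) => u v; rewrite !dotE (dotC v u); ring.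
rewrite !sqE sqr_enorm_conv.
have -> : (1 - s) *: (y1 - p) + s *: (y2 - p) - (q - p)
    = (1 - s) *: y1 + s *: y2 - q by apply/rowP => i; rewrite !mxE; ring.
by lra.
Qed.

Lemma continuous_enorm_affine x y : continuous (fun t : R => enorm (x + t *: y)).
Proof.
move=> t0.
under [X in continuous_at _ X]eq_fun do rewrite enormE.
apply: continuous_comp; last exact: sqrt_continuous.
have -> : (fun t => dot (x + t *: y) (x + t *: y))
    = (fun t => dot x x + t * (2 * dot x y) + t * t * dot y y).
  by apply/funext => t; rewrite !dotE (dotC y x); ring.
apply: cvgD; first apply: cvgD; first exact: cvg_cst.
  by apply: cvgM; [exact: cvg_id|exact: cvg_cst].
apply: cvgM; last exact: cvg_cst.
by apply: cvgM; exact: cvg_id.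
Qed.

Lemma exists_shortest_broken_line p a e y : exists q, segment a e q /\
  forall q', segment a e q' ->
    enorm (p - q) + enorm (q - y) <= enorm (p - q') + enorm (q' - y).
Proof.
pose q (t : R) := (1 - t) *: a + t *: e.
have qE z t : q t - z = (a - z) + t *: (e - a).
  by apply/rowP => i; rewrite !mxE; ring.
have [] := @EVT_min R (fun t => enorm (p - q t) + enorm (q t - y)) 0 1 ler01.
  apply: continuous_subspaceT.
  have -> : (fun t => enorm (p - q t) + enorm (q t - y)) =
      (fun t => enorm ((a - p) + t *: (e - a)) + enorm ((a - y) + t *: (e - a))).
    by apply/funext => t; rewrite enormB !qE.
  by move=> t; apply: cvgD; exact: continuous_enorm_affine.
move=> t t01 tmin; exists (q t); split; first by exists t => //; move: t01; rewrite in_itv.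
by move=> _ [t' t'01 <-]; apply: tmin; rewrite in_itv.
Qed.

(** Partial converse of [boxtimes_through]: [al] and [be] play the distances from [x] and [z] to a
    point dividing [[y, w]] in the ratio s : 1 - s. *)
Lemma boxtimes_of_midpoint (T : Type) (d : T -> T -> R) (t s : R) (x y z w : T)
    (al be : R) : 0 <= t <= 1 -> 0 <= al -> 0 <= be -> 0 <= d x z ->
  al ^+ 2 <= (1 - s) * d x y ^+ 2 + s * d w x ^+ 2 - s * (1 - s) * d y w ^+ 2 ->
  be ^+ 2 <= (1 - s) * d y z ^+ 2 + s * d z w ^+ 2 - s * (1 - s) * d y w ^+ 2 ->
  d x z <= al + be ->
  0 <= (1 - t) * (1 - s) * d x y ^+ 2 + t * (1 - s) * d y z ^+ 2
         + t * s * d z w ^+ 2 + (1 - t) * s * d w x ^+ 2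
         - t * (1 - t) * d x z ^+ 2 - s * (1 - s) * d y w ^+ 2.
Proof.
move=> /andP[t0 t1] al0 be0 dxz ha hb h.
have h1 : t * (1 - t) * d x z ^+ 2 <= (1 - t) * al ^+ 2 + t * be ^+ 2.
  apply: (@le_trans _ _ (t * (1 - t) * (al + be) ^+ 2)).
    by rewrite ler_wpM2l ?mulr_ge0 ?subr_ge0// ler_pXn2r// nnegrE ?addr_ge0.
  by have := sqr_ge0 ((1 - t) * al - t * be); lra.
have t1' : 0 <= 1 - t by lra.
have := lerD (ler_wpM2l t1' ha) (ler_wpM2l t0 hb); lra.
Qed.

(** The quadruple [x, x, z, w] with [a = d x z], [b = d x w], [c = d z w]: the expression equals (ta
    - sb)^2 + ts(c^2 - (a - b)^2). *)
Lemma boxtimes_degenerate (a b c t s : R) : 0 <= a -> 0 <= b -> 0 <= c ->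
  a <= b + c -> b <= a + c -> 0 <= t <= 1 -> 0 <= s <= 1 ->
  0 <= t * (1 - s) * a ^+ 2 + t * s * c ^+ 2 + (1 - t) * s * b ^+ 2
       - t * (1 - t) * a ^+ 2 - s * (1 - s) * b ^+ 2.
Proof.
move=> a0 b0 c0 h1 h2 /andP[t0 t1] /andP[s0 s1].
have h : (a - b) ^+ 2 <= c ^+ 2 by rewrite -subr_ge0 subr_sqr mulr_ge0//; lra.
have := ler_wpM2l (mulr_ge0 t0 s0) h.
by have := sqr_ge0 (t * a - s * b); lra.
Qed.

(* R^n glued to a flat triangle with apex [p] along the segment [a, e];
   [None] stands for the apex. *)
Lemma glued_metric p a e : exists D : option 'rV[R]_n -> option 'rV[R]_n -> R,
  [/\ boxtimes_metric D, forall x y, D (Some x) (Some y) = enorm (x - y),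
      forall y q, segment a e q -> D None (Some y) <= enorm (p - q) + enorm (q - y) &
      forall y, exists2 q, segment a e q &
        D None (Some y) = enorm (p - q) + enorm (q - y)].
Proof.
have [Q HQ] := choice (exists_shortest_broken_line p a e).
pose f y := enorm (p - Q y) + enorm (Q y - y).
pose D (x y : option 'rV[R]_n) := match x, y with
  | None, None => 0 | None, Some y => f y | Some x, None => f x
  | Some x, Some y => enorm (x - y) end.
have fmin y q : segment a e q -> f y <= enorm (p - q) + enorm (q - y).
  by move=> aeq; have [_] := HQ y; exact.
exists D; split=> //; last by move=> y; exists (Q y) => //; have [] := HQ y.
pose V := option 'rV[R]_n.
have D0 (x : V) : D x x = 0 by case: x => [x|] //=; rewrite subrr enorm0.
have DC (x y : V) : D x y = D y x by case: x y => [x|] [y|] //=; rewrite enormB.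
have Dge0 (x y : V) : 0 <= D x y.
  by case: x y => [x|] [y|] //=; rewrite ?addr_ge0 ?enorm_ge0.
have fD m z : f z <= f m + enorm (m - z).
  apply: le_trans (fmin _ _ (proj1 (HQ m))) _.
  by rewrite -addrA lerD2l; exact: enorm_triangle.
have Dtri (x y z : V) : D x z <= D x y + D y z.
  case: x y z => [x|] [y|] [z|] //=; rewrite ?addr0 ?add0r ?addr_ge0 ?enorm_ge0//.
  - exact: enorm_triangle.
  - by rewrite enormB addrC; exact: fD.
  - apply: le_trans (enorm_triangle _ p _) _; rewrite /f.
    have := enorm_triangle x (Q x) p; have := enorm_triangle p (Q z) z.
    by rewrite (enormB x (Q x)) (enormB (Q x) p); lra.
(* The dividing point of [[y, w]] exists in R^n: Stewart's identity applies if [x] is in R^n too,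
   [broken_line_convex] if it is the apex. *)
have Dcat s (x : V) (y w : 'rV[R]_n) : 0 <= s <= 1 ->
    D x (Some ((1 - s) *: y + s *: w)) ^+ 2 <=
    (1 - s) * D x (Some y) ^+ 2 + s * D (Some w) x ^+ 2
    - s * (1 - s) * D (Some y) (Some w) ^+ 2.
  move=> s01; case: x => [x|] /=.
    by rewrite enormB sqr_enorm_conv (enormB x y).
  have [q qE] := broken_line_convex p (Q y) (Q w) y w s01.
  apply: le_trans; rewrite ler_pXn2r ?nnegrE ?addr_ge0 ?enorm_ge0//; apply: fmin.
  by apply: segment_convex qE; [have [] := HQ y|have [] := HQ w].
have boxS t s (x z : V) y w : 0 <= t <= 1 -> 0 <= s <= 1 ->
    0 <= (1 - t) * (1 - s) * D x (Some y) ^+ 2 + t * (1 - s) * D (Some y) z ^+ 2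
         + t * s * D z (Some w) ^+ 2 + (1 - t) * s * D (Some w) x ^+ 2
         - t * (1 - t) * D x z ^+ 2 - s * (1 - s) * D (Some y) (Some w) ^+ 2.
  move=> t01 s01; set m := Some ((1 - s) *: y + s *: w).
  apply: (@boxtimes_of_midpoint _ D t s x (Some y) z (Some w) (D x m) (D z m)) => //.
  - exact: Dcat.
  - by rewrite (DC (Some y) z) (DC z (Some w)); exact: Dcat.
  - by rewrite (DC z m); exact: Dtri.
pose box t s (x y z w : V) :=
  (1 - t) * (1 - s) * D x y ^+ 2 + t * (1 - s) * D y z ^+ 2
  + t * s * D z w ^+ 2 + (1 - t) * s * D w x ^+ 2
  - t * (1 - t) * D x z ^+ 2 - s * (1 - s) * D y w ^+ 2.
have boxT t s (x y z w : V) : box t s x y z w = box s t y x w z.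
  by rewrite /box (DC y x) (DC x w) (DC w z) (DC z y); ring.
have boxZ t s (x y z w : V) : box t s x y z w = box (1 - t) s z y x w.
  by rewrite /box (DC z y) (DC y x) (DC x w) (DC w z) (DC z x); ring.
have box_deg t s (x z w : V) : 0 <= t <= 1 -> 0 <= s <= 1 -> 0 <= box t s x x z w.
  move=> t01 s01; rewrite /box D0 (DC w x) expr0n mulr0 add0r.
  have h1 := Dtri x w z; rewrite (DC w z) in h1.
  exact: boxtimes_degenerate h1 (Dtri x z w) t01 s01.
have ivC t : 0 <= t <= 1 -> 0 <= 1 - t <= 1 by case/andP=> ? ?; apply/andP; split; lra.
split=> // t s x y z w t01 s01; rewrite -/(box t s x y z w).
have {}boxS t' s' (x' z' : V) y' w' : 0 <= t' <= 1 -> 0 <= s' <= 1 ->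
    0 <= box t' s' x' (Some y') z' (Some w') by exact: boxS.
have ivt := ivC _ t01; have ivs := ivC _ s01; clearbody box.
(* If a diagonal has both ends in R^n, [boxS] applies. Otherwise both diagonals contain the apex, so
   two adjacent vertices coincide, and the symmetries bring them to the first two places. *)
move: y w => [y|] [w|]; first exact: boxS.
all: move: x z => [x|] [z|]; first by rewrite boxT; exact: boxS.
- by rewrite boxZ boxT boxZ; apply: box_deg.
- by rewrite boxT boxZ; apply: box_deg.
- by rewrite boxT boxZ; apply: box_deg.
- by rewrite boxZ; apply: box_deg.
- by apply: box_deg.
- by apply: box_deg.
- by rewrite boxZ; apply: box_deg.
- by apply: box_deg.
- by apply: box_deg.
Qed.

End Gluing.

(** * Points and lines in the plane *)

Section ThroughEndpoint.
Variables (R : realType) (n : nat).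
Implicit Types (a e p q l x y : 'rV[R]_n).

Definition turns_at p a e y : Prop := forall q, segment a e q ->
  enorm (p - a) + enorm (a - y) <= enorm (p - q) + enorm (q - y).

(** By [pasch], [[q, x]] crosses [[a, y]] at some [r]; comparing the broken lines to [y] and
    exchanging the tails after [r] gives the claim for [x]. *)
Lemma turns_at_meet p a e x y :
  turns_at p a e y -> meet a y x e -> turns_at p a e x.
Proof.
move=> h [c [ayc xec]] q aeq; have hq := h q aeq.
rewrite segmentC in xec; rewrite segmentC in aeq.
have [r [acr /enorm_segment xqr]] := pasch aeq xec.
have ayr : segment a y r by apply: segment_convex acr => //; exact: segment_left.
have := enorm_segment ayr; have := enorm_triangle q r y.
have := enorm_triangle a r x; move: xqr; rewrite (enormB x q) (enormB x r) (enormB r q).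
by lra.
Qed.

(** The length of the broken line is convex in its turning point and minimal at [l], so it cannot
    decrease from [a] to [q]. *)
Lemma turns_at_beyond p a e l y : segment p y l ->
  (forall q, segment a e q -> segment l q a) -> turns_at p a e y.
Proof.
move=> pyl h q /h [t /= t01 <-].
have hp := enorm_conv l q p t01; have hy := enorm_conv l q y t01.
rewrite (enormB p) (enormB p q).
have := enorm_segment pyl; rewrite (enormB p l).
have := enorm_triangle p q y; rewrite (enormB p q).
case/andP: t01 => t0 t1 h1 h2.
have : 0 <= (1 - t) * (enorm (q - p) + enorm (q - y) - enorm (p - y)).
  by rewrite mulr_ge0// subr_ge0.
by rewrite h2; lra.
Qed.

End ThroughEndpoint.

(** * Orientation, triangles and the sides of a line *)

Section Plane.
Variable R : realType.
Implicit Types (a e p x y z : 'rV[R]_2) (s t : R).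

(** Twice the signed area of the triangle [a e x]. *)
Definition orient a e x : R :=
  (e - a) ord0 0 * (x - a) ord0 1 - (e - a) ord0 1 * (x - a) ord0 0.

Lemma dot2 (u v : 'rV[R]_2) : dot u v = u ord0 0 * v ord0 0 + u ord0 1 * v ord0 1.
Proof.
by rewrite /dot big_ord_recl big_ord1; congr (_ + _ * _); congr (_ _ _);
  apply: val_inj.
Qed.

Lemma orient_conv a e x y t :
  orient a e ((1 - t) *: x + t *: y) = (1 - t) * orient a e x + t * orient a e y.
Proof. by rewrite /orient !mxE; ring. Qed.

Lemma orient_left a e : orient a e a = 0.
Proof. by rewrite /orient !mxE; ring. Qed.

Lemma orient_right a e : orient a e e = 0.
Proof. by rewrite /orient !mxE; ring. Qed.

Lemma orient_eq0 a e x : a != e -> orient a e x = 0 ->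
  exists t, x = (1 - t) *: a + t *: e.
Proof.
move=> ae o0; have nz : dot (e - a) (e - a) != 0.
  by apply: contra_neq ae => /dot_eq0/eqP; rewrite subr_eq0 => /eqP.
exists (dot (x - a) (e - a) / dot (e - a) (e - a)).
suff h : x - a = (dot (x - a) (e - a) / dot (e - a) (e - a)) *: (e - a).
  rewrite -[LHS](subrK a) {1}h; move: (_ / _) => t.
  by apply/rowP => i; rewrite !mxE; ring.
apply: (scalerI nz); rewrite scalerA mulrCA divff// mulr1.
move: o0; rewrite /orient !dot2.
move: (x - a) (e - a) => u v o0.
apply/rowP => i; rewrite !mxE.
have [->|->] : i = 0 \/ i = 1.
  by case: i => -[|[|]]// ?; [left|right]; exact: val_inj.
all: apply/eqP; rewrite -subr_eq0; apply/eqP.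
- transitivity ((v ord0 1) * - (v ord0 0 * u ord0 1 - v ord0 1 * u ord0 0) : R).
    by ring.
  by rewrite o0; ring.
- transitivity ((v ord0 0) * (v ord0 0 * u ord0 1 - v ord0 1 * u ord0 0) : R).
    by ring.
  by rewrite o0; ring.
Qed.

(** The orientation of the crossing point is a nonnegative multiple of both orientations; opposite
    signs would make this point both [a] and [e]. *)
Lemma meet_orient a e x y : a != e -> meet a y x e ->
  0 <= orient a e x * orient a e y.
Proof.
move=> ae [c [[t /= /andP[t0 t1] tc] [s /= /andP[s0 s1] sc]]].
have := congr1 (orient a e) (etrans tc (esym sc)).
rewrite !orient_conv orient_left orient_right !mulr0 addr0 add0r => h.
rewrite leNgt; apply/negP => lt0.
have y0 : orient a e y != 0 by apply: contraTneq lt0 => ->; rewrite mulr0 ltxx.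
have h2 : t * orient a e y ^+ 2 = (1 - s) * (orient a e x * orient a e y).
  by rewrite mulrA h; ring.
have yp : 0 < orient a e y ^+ 2 by rewrite lt0r sqr_ge0 sqrf_eq0 y0.
have t00 : t = 0 by nra.
have s11 : s = 1 by nra.
move: tc sc; rewrite t00 s11 !subr0 !subrr !scale0r !scale1r addr0 add0r => <- ea.
by rewrite ea eqxx in ae.
Qed.

(** The sign [ep] selects the half-plane that receives the apex. *)
Lemma triangle_apex a e (A B ep : R) : 0 <= A -> 0 <= B -> ep ^+ 2 = 1 ->
  a != e -> enorm (e - a) <= A + B -> A <= enorm (e - a) + B ->
  B <= enorm (e - a) + A ->
  exists p, [/\ enorm (e - p) = A, enorm (p - a) = B & ep * orient a e p <= 0].
Proof.
move=> A0 B0 ep1 ae h1 h2 h3.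
set C := enorm (e - a) in h1 h2 h3 *.
have Cn : C != 0.
  by apply: contra_neq ae => /enorm_eq0/eqP; rewrite subr_eq0 => /eqP.
have C0 : 0 <= C by exact: enorm_ge0.
have Cp : 0 < C by rewrite lt0r Cn.
(* Law of cosines: [x] is the signed projection of [p - a] on [e - a], and [h] below is the
   height. *)
pose x : R := (B ^+ 2 + C ^+ 2 - A ^+ 2) / (2 * C).
have xE : 2 * C * x = B ^+ 2 + C ^+ 2 - A ^+ 2 by rewrite mulrC /x divfK// mulf_neq0.
have xB : x ^+ 2 <= B ^+ 2.
  have : - B <= x by rewrite /x ler_pdivlMr ?mulr_gt0//; nra.
  have : x <= B by rewrite /x ler_pdivrMr ?mulr_gt0//; nra.
  by move=> ? ?; nra.
pose h := Num.sqrt (B ^+ 2 - x ^+ 2).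
have hE : h ^+ 2 = B ^+ 2 - x ^+ 2 by rewrite sqr_sqrtr// subr_ge0.
have hh0 : 0 <= h by exact: sqrtr_ge0.
have CE : (e - a) ord0 0 ^+ 2 + (e - a) ord0 1 ^+ 2 = C ^+ 2.
  by rewrite sqr_enorm dot2 !expr2.
(* [u] is [e - a] turned clockwise by a right angle, hence on the negative side of the line. *)
pose u : 'rV[R]_2 := \row_(i < 2) (if i == 0 then (e - a) ord0 1 else - (e - a) ord0 0).
have u0 : u ord0 0 = (e - a) ord0 1 by rewrite mxE.
have u1 : u ord0 1 = - (e - a) ord0 0 by rewrite mxE.
clearbody x h u.
pose w := (x / C) *: (e - a) + (ep * h / C) *: u.
have wu : dot u u = C ^+ 2 by rewrite dot2 u0 u1 -CE; ring.
have wv : dot (e - a) u = 0 by rewrite dot2 u0 u1; ring.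
have vv : dot (e - a) (e - a) = C ^+ 2 by rewrite sqr_enorm.
have wB : dot w w = B ^+ 2.
  rewrite /w; move: wu wv vv; move: (e - a) => v wu wv vv.
  rewrite !dotE (dotC u v) wu wv vv.
  transitivity (x ^+ 2 + ep ^+ 2 * h ^+ 2); first by field.
  by rewrite ep1 hE; ring.
have wA : dot (e - a - w) (e - a - w) = A ^+ 2.
  have wv' : dot w (e - a) = x * C.
    rewrite /w; move: wu wv vv; move: (e - a) => v wu wv vv.
    by rewrite !dotE (dotC u v) wv vv; field.
  move: wv' vv wB; clearbody w; move: (e - a) => v wv' vv wB.
  by rewrite !dotE (dotC v w) wv' vv wB; lra.
exists (a + w); split.
- by apply: enorm_eq => //; rewrite opprD addrA.
- by apply: enorm_eq => //; rewrite addrC addKr.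
- rewrite /orient [a + w]addrC addrK /w.
  move: CE u0 u1; move: (e - a) => v CE u0 u1.
  rewrite !mxE u0 u1.
  have -> : ep * (v ord0 0 * (x / C * v ord0 1 + ep * h / C * - v ord0 0)
      - v ord0 1 * (x / C * v ord0 0 + ep * h / C * v ord0 1))
      = - (ep ^+ 2 * h / C * (v ord0 0 ^+ 2 + v ord0 1 ^+ 2)) by ring.
  by rewrite CE ep1 mul1r oppr_le0 mulr_ge0 ?divr_ge0 ?sqr_ge0.
Qed.

(** [[p, y]] meets the line through [a] and [e] in a point [l]; the three cases are [l] on the
    segment, beyond [a] and beyond [e]. *)
Lemma opposite_sides a e p y (ep : R) : a != e -> ep ^+ 2 = 1 ->
  ep * orient a e p <= 0 -> 0 <= ep * orient a e y ->
  [\/ meet p y a e, turns_at p a e y | turns_at p e a y].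
Proof.
move=> ae ep1 hp hy.
have epn : ep != 0 by apply: contra_eq_neq ep1 => ->; rewrite expr0n eq_sym oner_eq0.
have [s s01 os] : exists2 s, 0 <= s <= 1 &
    orient a e ((1 - s) *: p + s *: y) = 0.
  (* Equal orientations must both vanish, and then [l = p] will do. *)
  have [E|ne] := eqVneq (orient a e p) (orient a e y).
    exists 0; first by rewrite lexx ler01.
    rewrite orient_conv E subr0 mul1r mul0r addr0; apply: (mulfI epn).
    by rewrite mulr0; rewrite E in hp; apply: le_anti; rewrite hp.
  pose s := orient a e p / (orient a e p - orient a e y).
  have d0 : orient a e p - orient a e y != 0 by rewrite subr_eq0.
  have sE : s = - (ep * orient a e p) / (ep * orient a e y - ep * orient a e p).
    rewrite -mulrBr -mulrN -mulf_div divff// mul1r /s.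
    by rewrite -(opprB (orient a e p)) invrN mulrNN.
  have lt0 : 0 < ep * orient a e y - ep * orient a e p.
    rewrite lt0r subr_ge0 (le_trans hp hy) andbT -mulrBr mulf_neq0//.
    by rewrite -opprB oppr_eq0.
  exists s; first by rewrite sE ler_pdivlMr// ler_pdivrMr//; apply/andP; split; lra.
  by rewrite orient_conv /s; field.
set l := (1 - s) *: p + s *: y in os.
have pyl : segment p y l by exists s.
have [t lE] := orient_eq0 ae os.
have [t0|t0] := ltP t 0.
  apply: Or32; apply: turns_at_beyond pyl _ => _ [b /= /andP[b0 b1] <-].
  have bt : 0 < b - t by lra.
  exists (- t / (b - t)).
    by rewrite /= ler_pdivlMr// ler_pdivrMr//; apply/andP; split; lra.
  by rewrite lE; apply/rowP => i; rewrite !mxE; field; rewrite gt_eqF.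
have [t1|t1] := ltP 1 t.
  apply: Or33; apply: turns_at_beyond pyl _ => _ [b /= /andP[b0 b1] <-].
  have bt : 0 < t - (1 - b) by lra.
  exists ((t - 1) / (t - (1 - b))).
    by rewrite /= ler_pdivlMr// ler_pdivrMr//; apply/andP; split; lra.
  by rewrite lE; apply/rowP => i; rewrite !mxE; field; rewrite gt_eqF.
apply: Or31; exists l; split => //; exists t => //=.
by rewrite t0 t1.
Qed.

End Plane.

(** * Convex polygons and the induction *)

Section Polygons.
Variables (R : realType) (n : nat).
Implicit Types (g : nat -> 'rV[R]_n) (d : nat -> nat -> R) (p : 'rV[R]_n).

(** Convexity is expressed by crossing closed diagonals, which admits repeated and collinear
    vertices. *)
Definition convex_polygon m g : Prop := forall i j k l,
  (i < j)%N -> (j < k)%N -> (k < l)%N -> (l <= m)%N ->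
  meet (g i) (g k) (g j) (g l).

(* The vertices are [g 0, ..., g m], so the closing side joins [g m] to [g 0]. *)
Definition majorizes m d g : Prop :=
  [/\ forall i, (i < m)%N -> enorm (g i - g i.+1) = d i i.+1,
      enorm (g m - g 0) = d m 0,
      forall i j, (i <= m)%N -> (j <= m)%N -> d i j <= enorm (g i - g j) &
      convex_polygon m g].

Definition append m p g i := if i == m.+1 then p else g i.

Lemma append_last m p g : append m p g m.+1 = p.
Proof. by rewrite /append eqxx. Qed.

Lemma append_old m p g i : (i <= m)%N -> append m p g i = g i.
Proof. by rewrite /append => im; case: eqP => // E; rewrite E ltnn in im. Qed.

(** Pasch carries the crossing of [[p, g j]] from [[g 0, g m]] to [[g 0, g k]] in the triangle
    [g 0, g j, g m], then to [[g i, g k]] in the triangle [g 0, g j, g k]. *)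
Lemma append_convex m p g : convex_polygon m g ->
  (forall j, (0 < j < m)%N -> meet p (g j) (g 0) (g m)) ->
  convex_polygon m.+1 (append m p g).
Proof.
move=> cg pg.
have from0 j k : (0 < j)%N -> (j < k)%N -> (k <= m)%N -> meet p (g j) (g 0) (g k).
  move=> j0 jk; rewrite leq_eqVlt => /predU1P[E|km].
    by rewrite E; apply: pg; lia.
  have [x [x1 x2]] := cg 0 j k m j0 jk km (leqnn m).
  have [|c [c1 c2]] := pg j; first by lia.
  rewrite (segmentC (g j) (g m)) in x2; rewrite segmentC in c1; rewrite segmentC in c2.
  by apply: meet_revl; exact: meet_pasch x2 x1 c2 c1.
have new i j k : (i < j)%N -> (j < k)%N -> (k <= m)%N -> meet p (g j) (g i) (g k).
  case: i => [|i] ij jk km; first exact: from0.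
  have [x [x1 x2]] := cg 0 i.+1 j k isT ij jk km.
  have [|r [r1 r2]] := from0 j k _ jk km; first by lia.
  rewrite (segmentC (g i.+1)) in x2; rewrite segmentC in r1.
  by apply: meet_revl; apply: meet_revr; exact: meet_pasch x1 x2 r2 r1.
move=> i j k l ij jk kl; rewrite leq_eqVlt => /predU1P[E|lm].
  rewrite E append_last !append_old; try lia.
  by apply: meet_swap; apply: meet_revl; apply: new => //; lia.
by rewrite !append_old; try lia; apply: cg; lia.
Qed.

Lemma append_majorizes m d g p :
  (forall i, d i i = 0) -> (forall i j, d i j = d j i) -> majorizes m d g ->
  enorm (g m - p) = d m m.+1 -> enorm (p - g 0) = d m.+1 0 ->
  (forall j, (0 < j < m)%N -> d j m.+1 <= enorm (g j - p)) ->
  (forall j, (0 < j < m)%N -> meet p (g j) (g 0) (g m)) ->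
  majorizes m.+1 d (append m p g).
Proof.
move=> d0 dC [side _ diag cg] gmp pg0 hd hm.
have dp j : (j <= m)%N -> d j m.+1 <= enorm (g j - p).
  move=> jm; have [->|jn] := eqVneq j m; first by rewrite gmp.
  have [->|j0] := eqVneq j 0; first by rewrite enormB pg0 dC.
  by apply: hd; lia.
split; last exact: append_convex.
- move=> i; rewrite ltnS leq_eqVlt => /predU1P[->|im].
    by rewrite append_last append_old.
  by rewrite !append_old; [exact: side|lia|lia].
- by rewrite append_last append_old.
- move=> i j; rewrite leq_eqVlt => /predU1P[->|im]; rewrite leq_eqVlt => /predU1P[->|jm].
  + by rewrite d0 enorm_ge0.
  + by rewrite append_last append_old// dC enormB; exact: dp.
  + by rewrite append_last append_old//; exact: dp.
  + by rewrite !append_old//; exact: diag.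
Qed.

Lemma majorizes_le m d d' g :
  (forall i, (i < m)%N -> d' i i.+1 = d i i.+1) -> d' m 0 = d m 0 ->
  (forall i j, (i <= m)%N -> (j <= m)%N -> d i j <= d' i j) ->
  majorizes m d' g -> majorizes m d g.
Proof.
move=> h1 h2 h3 [s c dg cg]; split=> //.
- by move=> i im; rewrite s// h1.
- by rewrite c.
- by move=> i j im jm; apply: le_trans (h3 _ _ im jm) _; exact: dg.
Qed.

Definition rot_next m i := if i == m then 0 else i.+1.
Definition rot_prev m i := if i == 0 then m else i.-1.

(** Relabelling moves vertex [0] to the last place, the one that [insert_straight_vertex] fills. *)
Lemma majorizes_rot_next m d g : (0 < m)%N ->
  majorizes m (fun i j => d (rot_next m i) (rot_next m j)) g ->
  majorizes m d (g \o rot_prev m).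
Proof.
move=> m0 [side close diag cg]; rewrite /rot_next in side close diag.
split => /=.
- case=> [|i] im; rewrite /rot_prev /=; first by rewrite close eqxx ifN//; lia.
  by rewrite side ?ifN//; lia.
- rewrite /rot_prev /= ifN; last by lia.
  by have := side m.-1; rewrite prednK// leqnn eqxx ifN; [apply|lia].
- have nextK i : (i <= m)%N -> rot_next m (rot_prev m i) = i.
    by rewrite /rot_next /rot_prev; case: i => [|i] im /=; rewrite ?eqxx// ifN//; lia.
  move=> i j im jm; rewrite -{1}(nextK i im) -{1}(nextK j jm); apply: diag;
  by rewrite /rot_prev; case: ifP; lia.
- move=> i j k l ij jk kl lm; rewrite /rot_prev /=.
  rewrite (_ : (j == 0) = false); last by lia.
  rewrite (_ : (k == 0) = false); last by lia.
  rewrite (_ : (l == 0) = false); last by lia.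
  case: eqP => [i0|/eqP i0]; last by apply: cg; lia.
  by apply: meet_swap; apply: meet_revr; apply: cg; lia.
Qed.

Lemma majorizes_rot_prev m d g : (0 < m)%N ->
  majorizes m (fun i j => d (rot_prev m i) (rot_prev m j)) g ->
  majorizes m d (g \o rot_next m).
Proof.
move=> m0 [side close diag cg]; rewrite /rot_prev in side close diag.
split => /=.
- move=> i im; rewrite /rot_next ifN; last by lia.
  case: eqP => [E|/eqP ne]; last by rewrite side//; lia.
  by rewrite E close ifN /=; [congr (d _ _)|]; lia.
- by rewrite /rot_next eqxx ifN /=; [rewrite side|lia].
- have prevK i : (i <= m)%N -> rot_prev m (rot_next m i) = i.
    by rewrite /rot_next /rot_prev; case: (eqVneq i m) => [->|].
  move=> i j im jm; rewrite -{1}(prevK i im) -{1}(prevK j jm); apply: diag;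
  by rewrite /rot_next; case: ifP; lia.
- move=> i j k l ij jk kl lm; rewrite /rot_next /=.
  rewrite (_ : (i == m) = false); last by lia.
  rewrite (_ : (j == m) = false); last by lia.
  rewrite (_ : (k == m) = false); last by lia.
  case: eqP => [i0|/eqP i0]; last by apply: cg; lia.
  by apply: meet_swap; apply: meet_revl; apply: cg; lia.
Qed.

(** The new vertex divides the closing side in the ratio of its distances in [d]. As [m.+1] itself
    divides the pair [m, 0], [boxtimes_through] applies with [b = 0]. *)
Lemma insert_straight_vertex m d g : boxtimes_metric d ->
  d m 0 = d m m.+1 + d m.+1 0 -> majorizes m d g ->
  exists g', majorizes m.+1 d g'.
Proof.
move=> bd; have [d0 dC dge0 _] := bd => E gd.
have [side close diag cg] := gd.
have [t t01 tA] : exists2 t, 0 <= t <= 1 & d m m.+1 = t * d m 0.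
  have A0 := dge0 m m.+1; have B0 := dge0 m.+1 0.
  have [z|nz] := eqVneq (d m 0) 0; first by exists 0; [rewrite lexx ler01|lra].
  have p : 0 < d m 0 by rewrite lt0r nz dge0.
  exists (d m m.+1 / d m 0); last by rewrite divfK.
  by rewrite ler_pdivlMr// ler_pdivrMr//; apply/andP; split; lra.
have tB : d m.+1 0 = (1 - t) * d m 0 by rewrite mulrBl mul1r -tA E; ring.
have /andP[t0 t1] := t01.
pose p := (1 - t) *: g m + t *: g 0.
have gmp : enorm (g m - p) = d m m.+1.
  have -> : g m - p = t *: (g m - g 0) by apply/rowP => i; rewrite !mxE; ring.
  by rewrite enormZ ger0_norm// close tA.
have pg0 : enorm (p - g 0) = d m.+1 0.
  have -> : p - g 0 = (1 - t) *: (g m - g 0) by apply/rowP => i; rewrite !mxE; ring.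
  by rewrite enormZ ger0_norm ?subr_ge0// close tB.
exists (append m p g); apply: append_majorizes => // j jm; last first.
  exists p; split; first exact: segment_left.
  by rewrite segmentC; exists t.
rewrite -[leRHS]addr0; apply: (boxtimes_through bd (x := m) (z := 0) t01) => //.
- exact: enorm_ge0.
- rewrite enormB sqr_enorm_conv close; apply: lerD => //.
  have h1 := diag m j (leqnn m) (ltac:(lia)); have h2 := diag 0 j isT (ltac:(lia)).
  rewrite (dC j 0) lerD// ler_wpM2l ?subr_ge0// ler_pXn2r ?nnegrE ?enorm_ge0//.
- by rewrite tA tB expr0n /=; lra.
Qed.

End Polygons.

(** * The induction in the plane *)

Section PlanePolygons.
Variable R : realType.
Implicit Types (g : nat -> 'rV[R]_2) (d : nat -> nat -> R).

Lemma exists_enorm (r : R) : 0 <= r -> exists u : 'rV[R]_2, enorm u = r.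
Proof.
move=> r0; exists (\row_(i < 2) (r *+ (i == 0))); apply: enorm_eq => //.
by rewrite dot2 !mxE /= mulr1n mulr0n; ring.
Qed.

(** By [meet_orient], no two vertices lie strictly on opposite sides of the closing side. *)
Lemma convex_polygon_side m g : convex_polygon m g -> g 0 != g m ->
  exists2 ep : R, ep ^+ 2 = 1 &
    forall j, (0 < j < m)%N -> 0 <= ep * orient (g 0) (g m) (g j).
Proof.
move=> cg ne; set o := fun j => orient (g 0) (g m) (g j).
have [all0|] := pselect (forall j, (0 < j < m)%N -> 0 <= o j).
  by exists 1; [rewrite expr1n|move=> j /all0; rewrite mul1r].
move=> /existsNP[i /not_implyP[im /negP]]; rewrite -ltNge => oi.
exists (-1); first by rewrite sqrrN expr1n.
move=> j jm; rewrite mulN1r oppr_ge0 leNgt; apply/negP; rewrite -/(o j) => oj.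
have : 0 <= o i * o j.
  have [ij|ji|E] := ltngtP i j; last by rewrite E -expr2 sqr_ge0.
    by apply: meet_orient ne _; apply: cg; lia.
  by rewrite mulrC; apply: meet_orient ne _; apply: cg; lia.
by rewrite leNgt nmulr_rlt0 ?oj.
Qed.

Lemma polygon_apex m g (A B : R) : convex_polygon m g -> 0 <= A -> 0 <= B ->
  enorm (g m - g 0) <= A + B -> A <= enorm (g m - g 0) + B ->
  B <= enorm (g m - g 0) + A ->
  exists p, [/\ enorm (g m - p) = A, enorm (p - g 0) = B &
    forall j, (0 < j < m)%N -> [\/ meet p (g j) (g 0) (g m),
      turns_at p (g 0) (g m) (g j) | turns_at p (g m) (g 0) (g j)]].
Proof.
move=> cg A0 B0 h1 h2 h3; have [E|ne] := eqVneq (g 0) (g m).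
  (* The closing side is a single point, through which every broken line passes; [A = B] follows,
     and any direction serves for [p]. *)
  have [u uA] := exists_enorm A0.
  move: h1 h2 h3; rewrite -E subrr enorm0 !add0r => _ h2 h3.
  exists (g 0 + u); split.
  - by rewrite opprD addrA subrr sub0r enormN.
  - by rewrite addrC addKr uA; apply: le_anti; rewrite h2.
  - move=> j _; apply: Or32 => _ [t _ <-].
    by rewrite -scalerDl subrK scale1r.
have [ep ep1 side] := convex_polygon_side cg ne.
have [p [pA pB pep]] := triangle_apex A0 B0 ep1 ne h1 h2 h3.
exists p; split => // j jm.
exact: opposite_sides ne ep1 pep (side j jm).
Qed.

Theorem polygon_majorization m d : (0 < m)%N -> boxtimes_metric d ->
  exists g, majorizes m d g.
Proof.
elim: m d => // -[_|m IH] d _ bd; have [d0 dC dge0 _] := bd.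
  have [u uE] := exists_enorm (dge0 0 1).
  exists (fun i => if i == 0 then 0 else u); split=> /=.
  - by case=> // _; rewrite /= sub0r enormN uE.
  - by rewrite subr0 uE dC.
  - by move=> [|[|i]] [|[|j]] //= _ _; rewrite ?subrr ?enorm0
       ?sub0r ?subr0 ?enormN ?uE ?d0// dC.
  - by move=> i j k l; lia.
(* From here on the majorized polygon has vertices [0, ..., m], and [m.+1] is the vertex to
   attach. *)
move: m.+1 (ltn0Sn m) IH => {}m m0 IH.
have tri := boxtimes_triangle bd.
have [g gd] := IH d m0 bd; have [side close diag cg] := gd.
have [|||p [pA pB pj]] := polygon_apex cg (dge0 m m.+1) (dge0 m.+1 0).
- by rewrite close; exact: tri.
- by rewrite close (dC m.+1 0); exact: tri.
- by rewrite close (dC m.+1 0) (dC m 0); exact: tri.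
(* [boxtimes_through] at the point dividing [[g 0, g m]]: seen from [j], distances in [d] are at
   most the Euclidean ones; seen from [m.+1], they agree. *)
have broken q j : segment (g 0) (g m) q -> (j <= m)%N ->
    d j m.+1 <= enorm (p - q) + enorm (q - g j).
  move=> [t t01 <-] jm; rewrite addrC (enormB p).
  have /andP[t0 t1] := t01; have t1' : 0 <= 1 - t by rewrite subr_ge0.
  have sqd i k : (i <= m)%N -> (k <= m)%N -> d i k ^+ 2 <= enorm (g i - g k) ^+ 2.
    by move=> im km; rewrite ler_pXn2r ?nnegrE ?enorm_ge0//; exact: diag.
  apply: (boxtimes_through bd (x := 0) (z := m) t01); rewrite ?enorm_ge0// sqr_enorm_conv.
  - rewrite (enormB (g 0) (g m)) close (dC 0 m) (dC j m) lerD2r.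
    by apply: lerD; apply: ler_wpM2l => //; exact: sqd.
  - rewrite (enormB (g 0) (g m)) close (dC 0 m) pA (enormB (g 0)) pB.
    by rewrite (dC m.+1 m) (dC 0).
have [all_meet|] := pselect (forall j, (0 < j < m)%N -> meet p (g j) (g 0) (g m)).
  exists (append m p g); apply: append_majorizes => // j jm.
  have [c [cp cg0m]] := all_meet j jm.
  rewrite enormB (enorm_segment cp); apply: broken => //; lia.
move=> /existsNP[j /not_implyP[jm nmeet]].
have [D [bD DE Dle Dge]] := glued_metric p (g 0) (g m).
have [_ DC Dge0 _] := bD.
(* [d'] below is the glued distance between the vertices of [g] and the apex: at least [d], and
   equal to [d] on the sides. *)
pose v i := if i == m.+1 then None else Some (g i).
have v_old i : (i <= m)%N -> v i = Some (g i).
  by rewrite /v => im; rewrite ifN//; lia.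
have v_last : v m.+1 = None by rewrite /v eqxx.
pose d' i k := D (v i) (v k).
have d'old i k : (i <= m)%N -> (k <= m)%N -> d' i k = enorm (g i - g k).
  by move=> im km; rewrite /d' !v_old.
have d'C i k : d' i k = d' k i by exact: DC.
have bd' : boxtimes_metric d' by exact: boxtimes_metric_comp.
have d'_turn a e k : (k <= m)%N -> segment a e = segment (g 0) (g m) ->
    turns_at p a e (g k) -> d' m.+1 k = enorm (p - a) + enorm (a - g k).
  move=> km aeE h; apply: le_anti; rewrite /d' v_last v_old//; apply/andP; split.
    by apply: Dle; rewrite -aeE; exact: segment_left.
  by have [q qE ->] := Dge (g k); apply: h; rewrite aeE.
have turns_self a e : turns_at p a e a.
  by move=> q _; rewrite subrr enorm0 addr0; exact: enorm_triangle.
have d'0 : d' m.+1 0 = d m.+1 0.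
  by rewrite (d'_turn (g 0) (g m) 0)// subrr enorm0 addr0 pB.
have d'm : d' m.+1 m = d m m.+1.
  rewrite (d'_turn (g m) (g 0) m)//; last exact: segmentC.
  by rewrite subrr enorm0 addr0 enormB pA.
have d'_last i : (i <= m)%N -> d i m.+1 <= d' i m.+1.
  move=> im; rewrite d'C /d' v_last v_old//.
  by have [q qE ->] := Dge (g i); exact: broken.
suff [g' g'd] : exists g', majorizes m.+1 d' g'.
  exists g'; apply: majorizes_le g'd => //.
  - move=> i; rewrite ltnS leq_eqVlt => /predU1P[->|im]; first by rewrite d'C.
    by rewrite d'old; [exact: side|lia|lia].
  - move=> i k; rewrite leq_eqVlt => /predU1P[->|im];
      rewrite leq_eqVlt => /predU1P[->|km].
    + by rewrite d0; exact: Dge0.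
    + by rewrite dC d'C; exact: d'_last.
    + exact: d'_last.
    + by rewrite d'old//; exact: diag.
have /andP[j0 jlt] := jm.
case: (pj j jm) => // turn.
(* For [j] other than [1], [[g 0, g j]] crosses [[g 1, g m]], which passes the turn on to the
   neighbour [1]. *)
- have turn1 : turns_at p (g 0) (g m) (g 1).
    have [<-//|j1] := eqVneq j 1.
    by apply: turns_at_meet turn _; apply: cg; lia.
  (* After the shift vertex [0] is last, so the induction hypothesis leaves it out; in [d'] it lies
     straight between [m.+1] and [1]. *)
  have [|g1 g1d] := IH (fun i k => d' (rot_next m.+1 i) (rot_next m.+1 k)) m0.
    exact: boxtimes_metric_comp.
  have [||g2 g2d] := insert_straight_vertex _ _ g1d.
  + exact: boxtimes_metric_comp.
  + rewrite /rot_next eqxx /= ifN; last by lia.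
    by rewrite (d'_turn _ _ _ _ erefl turn1)// d'0 -pB d'old.
  by exists (g2 \o rot_prev m.+1); exact: majorizes_rot_next.
(* Mirror case: shifting by [rot_prev] makes [m] the last vertex, straight between [m.-1] and
   [m.+1]. *)
- have turn1 : turns_at p (g m) (g 0) (g m.-1).
    have [<-//|j1] := eqVneq j m.-1.
    apply: turns_at_meet turn _.
    by apply: meet_swap; apply: meet_revl; apply: meet_revr; apply: cg; lia.
  have [|g1 g1d] := IH (fun i k => d' (rot_prev m.+1 i) (rot_prev m.+1 k)) m0.
    exact: boxtimes_metric_comp.
  have [||g2 g2d] := insert_straight_vertex _ _ g1d.
  + exact: boxtimes_metric_comp.
  + rewrite /rot_prev /= ifN; last by lia.
    rewrite d'C (d'_turn _ _ _ _ (segmentC _ _) turn1) ?leq_pred//.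
    by rewrite (d'C m) d'm -pA d'old ?leq_pred// (enormB p) (enormB (g m) (g m.-1)) addrC.
  by exists (g2 \o rot_next m.+1); exact: majorizes_rot_prev.
Qed.

End PlanePolygons.

(** * From polygons indexed by integers to cyclic ones *)

Lemma boxtimes_metric_mdist (R : realType) (X : metricType R) :
  boxtimes_inequalities X -> boxtimes_metric (@mdist R X).
Proof.
by move=> box; split; [exact: mdistxx|exact: metric_sym|exact: mdist_ge0|exact: box].
Qed.

(** If [j] is a cyclic neighbour of [i], the segments share [g j]; otherwise [i] and [j] separate
    the two neighbours of [i] in the cyclic order. *)
Lemma convex_polygon_meet (R : realType) (n m : nat) (g : nat -> 'rV[R]_n)
    (i j : nat) : convex_polygon m g -> (0 < m)%N -> (i <= m)%N -> (j <= m)%N ->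
  i != j -> meet (g i) (g j) (g (rot_prev m i)) (g (rot_next m i)).
Proof.
move=> cg m0 im jm ij.
have [->|jp] := eqVneq j (rot_prev m i).
  by exists (g (rot_prev m i)); split; [exact: segment_right|exact: segment_left].
have [->|jn] := eqVneq j (rot_next m i).
  by exists (g (rot_next m i)); split; exact: segment_right.
move: jp jn; rewrite /rot_prev /rot_next.
case: (eqVneq i 0) => [i0|i0]; case: (eqVneq i m) => [iE|iE] jp jn.
- by lia.
- by rewrite i0; apply: meet_revr; apply: cg; lia.
- by rewrite iE; apply: meet_swap; apply: meet_revl; apply: meet_revr;
    apply: cg; lia.
- have [lt|ge] := ltnP j i.
    by apply: meet_revl; apply: cg; lia.
  by apply: meet_swap; apply: cg; lia.
Qed.

Theorem corollary1p11 (R : realType) (X : metricType R)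
    (hX : boxtimes_inequalities X) (n : nat) (hn : (3 <= n)%N)
    (f : 'Z_n -> X) (hf : forall j : 'Z_n, f j <> f (j + 1)) :
  exists g : 'Z_n -> 'rV[R]_2,
    (forall i j : 'Z_n,
        enorm (g i - g (i + 1)) = mdist (f i) (f (i + 1)) /\
        mdist (f i) (f j) <= enorm (g i - g j)) /\
    (forall i j : 'Z_n, i <> j ->
        segment (g i) (g j) `&` segment (g (i - 1)) (g (i + 1)) !=set0).
Proof.
case: n hn f hf => [|[|[|n]]]// _ f _; set m := n.+2.
(* The indices [0, ..., m] run once through the classes modulo [n.+3], and adding or subtracting 1
   becomes [rot_next] or [rot_prev]. *)
pose F (i : nat) : X := f (inZp i).
have [g [side close diag cg]] := polygon_majorization (ltn0Sn n.+1)
  (boxtimes_metric_comp F (boxtimes_metric_mdist hX)).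
have FE (i : 'Z_n.+3) : F i = f i by rewrite /F valZpK.
have le_m (i : 'Z_n.+3) : (i <= m)%N by rewrite -ltnS; exact: (ltn_ord i).
have nextE (i : 'Z_n.+3) : (i + 1 : 'Z_n.+3) = rot_next m i :> nat.
  change ((i + 1 %% n.+3) %% n.+3 = rot_next m i)%N.
  rewrite /rot_next (@modn_small 1)// addn1.
  case: (eqVneq (i : nat) m) => [->|im]; first by rewrite modnn.
  by rewrite modn_small//; have := le_m i; rewrite /m in im *; lia.
have prevE (i : 'Z_n.+3) : (i - 1 : 'Z_n.+3) = rot_prev m i :> nat.
  have : (i - 1 + 1 : 'Z_n.+3) = i by rewrite subrK.
  move=> /(congr1 (@nat_of_ord _)); rewrite nextE /rot_next /rot_prev.
  have := le_m (i - 1).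
  by case: (eqVneq (nat_of_ord (i - 1)) m) => [-> _ <-//|h1 h2 <-].
exists (fun i => g i); split=> [i j|i j ij].
  split; last by rewrite -!FE; exact: diag.
  rewrite -!FE nextE /rot_next; case: (eqVneq (i : nat) m) => [->|im]; first exact: close.
  by apply: side; rewrite ltn_neqAle im; exact: le_m.
rewrite prevE nextE; apply: (convex_polygon_meet cg) => //.
by apply/eqP => /val_inj.
Qed.
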